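(* Let $m=2k+1$ be odd and let $m\ge n\ge 3$. If $S$ is an optimal contamination set of $G(n,m)$ and $|S|=k+1$, then: 1. each odd column (column of odd index) contains exactly one cell of $S$; 2. each even column contains no cell of $S$. In particular, every optimal solution is supported on the odd columns $1,3,5,\dots,2k+1$.
   Context: For integers $n,m\ge 1$, the grid $G(n,m)$ has cell set $V_{n,m}=\{(i,j): 1\le i\le n,\ 1\le j\le m\}$ ($i$ = row, $j$ = column). Contamination rules: a cell $u=(i,j)\in V_{n,m}$ can be contaminated by two contaminated cells $v,w\in V_{n,m}$ if one of the following holds: (a) $v=(i-1,j-1)$, $w=(i+1,j+1)$; (b) $v=(i+1,j-1)$, $w=(i-1,j+1)$; (c) $v=(i-1,j)$, $w=(i+1,j)$; (d) $v=(i,j-1)$, $w=(i,j+1)$; (e) $v=(i,j-1)$, $w=(i-1,j)$; (f) $v=(i,j-1)$, $w=(i+1,j)$; (g) $v=(i+1,j)$, $w=(i,j+1)$; (h) $v=(i-1,j)$, $w=(i,j+1)$. For $S\subseteq V_{n,m}$, the final contaminated set $C(S)$ is the smallest subset of $V_{n,m}$ containing $S$ and closed under rules (a)--(h). $S$ is a contaminating set if $C(S)=V_{n,m}$. The power contamination number $\gamma_c(G(n,m))$ is the minimum cardinality of a contaminating set, and a contaminating set $S$ with $|S|=\gamma_c(G(n,m))$ is called an optimal contamination set (optimal solution). A set is supported on the odd columns if all its cells lie in columns of odd index. *)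

(* Defs.v *)
From mathcomp Require Import all_boot.

Set Implicit Arguments.
Unset Strict Implicit.
Unset Printing Implicit Defensive.

Notation cell n m := ('I_n * 'I_m)%type.

Section Contamination.

Variables n m : nat.
Implicit Types (u v w : cell n m) (S T : {set cell n m}).

(* The ordinals count from 0, the coordinates (row, column) of a cell from 1. *)
Definition coords u : nat * nat := (u.1.+1, u.2.+1).

(* Both coordinates of u are at least 1, so i - 1 and j - 1 do not truncate;  *)
(* no cell has a coordinate equal to 0.                                       *)
Definition contaminable_by u v w : bool :=
  let: (i, j) := coords u in
  [|| (coords v == (i - 1, j - 1)) && (coords w == (i + 1, j + 1)),
      (coords v == (i + 1, j - 1)) && (coords w == (i - 1, j + 1)),
      (coords v == (i - 1, j)) && (coords w == (i + 1, j)),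
      (coords v == (i, j - 1)) && (coords w == (i, j + 1)),
      (coords v == (i, j - 1)) && (coords w == (i - 1, j)),
      (coords v == (i, j - 1)) && (coords w == (i + 1, j)),
      (coords v == (i + 1, j)) && (coords w == (i, j + 1))
    | (coords v == (i - 1, j)) && (coords w == (i, j + 1))].

Definition contamination_closed T : bool :=
  [forall u, forall v in T, forall w in T,
     contaminable_by u v w ==> (u \in T)].

Definition final_contaminated S : {set cell n m} :=
  \bigcap_(T : {set cell n m} | (S \subset T) && contamination_closed T) T.

Definition contaminating S : bool := final_contaminated S == [set: cell n m].

Definition column (j : nat) : {set cell n m} := [set u | (coords u).2 == j].

Definition supported_on_odd_columns S : Prop :=
  forall u, u \in S -> odd (coords u).2.

End Contamination.

(* The full cell set is contaminating (contaminatingT), so the minimum is     *)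
(* attained.                                                                  *)
Definition power_contamination_number (n m : nat) : nat :=
  #|[arg min_(S < [set: cell n m] | contaminating S) #|S|]|.

Definition optimal_contamination (n m : nat) (S : {set cell n m}) : bool :=
  contaminating S && (#|S| == power_contamination_number n m).

Lemma contaminatingT (n m : nat) : contaminating [set: cell n m].
Proof.
apply/eqP/setP=> u; rewrite inE; apply/bigcapP=> T /andP[/subsetP sT _].
exact: sT.
Qed.

(* Main.v *)
(* Two adjacent columns without contaminated cells stay uncontaminated for     *)
(* ever, since every rule applied to a cell of column j uses a cell of column  *)
(* j itself or one cell in each of the columns j - 1 and j + 1. With virtual   *)
(* empty columns 0 and m + 1 added, this covers the boundary columns too. So,  *)
(* if c j is the number of cells of S in column j, then c j + c (j + 1) >= 1   *)
(* for 0 <= j <= m; pairing the columns to the left and to the right of j      *)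
(* shows that S has exactly half of j (rounded down) cells to the left of      *)
(* column j, so c j is 1 for odd j and 0 for even j.                           *)
Require Import Defs.
From mathcomp Require Import all_boot zify.

Set Implicit Arguments.
Unset Strict Implicit.
Unset Printing Implicit Defensive.

(** By [closed_avoiding_adjacent_columns], the counts in columns [0] to [m + 1] have no two
    consecutive zeros; a total of [k + 1] over these [2k + 3] columns then leaves only the pattern
    0, 1, 0, ..., 1, 0 ([alternating_of_sum]). *)

Lemma half_leq_sum (f : nat -> nat) (a b : nat) :
  (forall i, i.+1 < b -> 0 < f i + f i.+1) ->
  (b - a)./2 <= \sum_(a <= i < b) f i.
Proof.
move=> f_gt0; elim: {a}(b - a) {-2}a (leqnn (b - a)) => [|d IHd] a le_d.
  have -> : b - a = 0 by lia.
  by [].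
have [lt_ab|ge_ab] := ltnP a.+1 b; last by have -> : (b - a)./2 = 0 by lia.
rewrite big_ltn ?(ltnW lt_ab) // big_ltn //.
have := IHd a.+2; have := f_gt0 a lt_ab; lia.
Qed.

Lemma alternating_of_sum (f : nat -> nat) (k : nat) :
  (forall i, i.+1 < k.*2.+3 -> 0 < f i + f i.+1) ->
  \sum_(0 <= i < k.*2.+3) f i = k.+1 ->
  forall j, j < k.*2.+3 -> f j = odd j.
Proof.
move=> f_gt0 f_sum.
(* The lower bounds for prefix and suffix add up to exactly [k.+1], as [k.*2.+3] is odd; so both are
   equalities. *)
have prefix_sum j : j <= k.*2.+3 -> \sum_(0 <= i < j) f i = j./2.
  move=> le_j.
  have := half_leq_sum j f_gt0.
  have : (j - 0)./2 <= \sum_(0 <= i < j) f i.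
    by apply: half_leq_sum => i /leq_trans/(_ le_j); apply: f_gt0.
  move: f_sum; rewrite (big_cat_nat (n := j)) //=; lia.
move=> j lt_j; have := prefix_sum _ lt_j; have := prefix_sum _ (ltnW lt_j).
rewrite big_nat_recr //=; lia.
Qed.

Section Columns.

Variables n m : nat.
Implicit Types S T : {set cell n m}.

Lemma final_contaminated_min S T :
  S \subset T -> contamination_closed T -> final_contaminated S \subset T.
Proof. by move=> sST clT; apply: bigcap_inf; rewrite sST. Qed.

Lemma closed_avoiding_adjacent_columns (j : nat) :
  contamination_closed (~: (column n m j :|: column n m j.+1)).
Proof.
apply/forallP=> u; apply/forall_inP=> v vT; apply/forall_inP=> w wT.
apply/implyP; move: vT wT; rewrite !inE /contaminable_by /coords /= !xpair_eqE.
lia.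
Qed.

Lemma contaminating_meets_adjacent_columns S (j : nat) :
  0 < n -> 0 < m -> j <= m -> contaminating S ->
  0 < #|S :&: column n m j| + #|S :&: column n m j.+1|.
Proof.
move=> n_gt0 m_gt0 le_jm /eqP defS; rewrite lt0n addn_eq0 !cards_eq0.
apply/negP; rewrite -setU_eq0 -setIUr setI_eq0 disjoints_subset => sST.
have := final_contaminated_min sST (closed_avoiding_adjacent_columns j).
(* The 0-based index [j.-1] is column [j], or column 1 when [j = 0]: a real column of the pair
   either way. *)
have lt_jm : j.-1 < m by lia.
rewrite defS => /subsetP/(_ (Ordinal n_gt0, Ordinal lt_jm)).
rewrite !inE /coords /=; lia.
Qed.

Lemma card_sum_columns S :
  #|S| = \sum_(0 <= j < m.+2) #|S :&: column n m j|.
Proof.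
rewrite big_mkord -sum1_card.
rewrite (partition_big (fun u : cell n m => inord u.2.+1 : 'I_m.+2) xpredT) //=.
apply: eq_bigr => j _; rewrite sum1dep_card; apply: eq_card => u.
by rewrite !inE /coords /= -val_eqE /= inordK // !ltnS ltnW ?ltn_ord.
Qed.

Lemma contaminating_card_column (k : nat) S :
  m = k.*2.+1 -> 0 < n -> contaminating S -> #|S| = k.+1 ->
  forall j, j <= m.+1 -> #|S :&: column n m j| = odd j.
Proof.
move=> def_m n_gt0 contS cardS j le_j.
apply: (alternating_of_sum (k := k)
          (f := fun j => #|S :&: column n m j|)) => [i lt_i||].
- by apply: contaminating_meets_adjacent_columns => //; lia.
- by rewrite -cardS card_sum_columns -def_m.
- by rewrite -def_m.
Qed.

End Columns.

Theorem lemma5 (n m k : nat) (Hm : m = 2 * k + 1) (Hn : 3 <= n) (Hnm : n <= m)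
    (S : {set cell n m}) (Sopt : optimal_contamination S)
    (Scard : #|S| = k + 1) :
  [/\ forall j : nat, 1 <= j <= m -> odd j -> #|S :&: column n m j| = 1,
      forall j : nat, 1 <= j <= m -> ~~ odd j -> S :&: column n m j = set0
    & forall T : {set cell n m},
        optimal_contamination T -> supported_on_odd_columns T].
Proof.
(* Any optimal [T] has as many cells as [S], hence [k + 1]. *)
have card_column T j : optimal_contamination T -> j <= m ->
    #|T :&: column n m j| = odd j.
  case/andP=> contT /eqP cardT le_j; case/andP: Sopt => _ /eqP cardS.
  by apply: (contaminating_card_column (k := k)) => //; lia.
split=> [j /andP[_ le_j] odd_j | j /andP[_ le_j] even_j | T Topt u uT].
- by rewrite card_column // odd_j.
- by apply/eqP; rewrite -cards_eq0 card_column // (negbTE even_j).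
have /(card_column _ (coords u).2 Topt) card_u : u.2 < m by [].
by rewrite -[odd _]lt0b -card_u; apply/card_gt0P; exists u; rewrite !inE uT /=.
Qed.
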